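(* Let $\pi$ be a permutation of $\mathbb{F}_2^m$ and let $S$ be a $k$-dimensional linear subspace of $\mathbb{F}_2^m$, $k\in\{1,2,\ldots,m-1\}$, such that $D_aD_b\pi=0_m$ (the constant zero function) for all $a,b\in S$. Denote by $V_S$ the linear subspace of $\mathbb{F}_2^m$ generated by the set $\{D_a\pi(y) : a\in S,\ y\in\mathbb{F}_2^m\}$. Then $\pi$ satisfies the property $(P_2)$ with respect to the subspace $S$ if and only if $\dim(V_S)>\dim(S)=k$.
   Context: For $F\colon\mathbb{F}_2^m\to\mathbb{F}_2^m$ and $a,b\in\mathbb{F}_2^m$: $D_aF(y)=F(y+a)+F(y)$ and $D_aD_bF(y)=F(y+a+b)+F(y+a)+F(y+b)+F(y)$. $0_m$ denotes the zero vector; $D_aD_bF=0_m$ means the function is identically $0_m$. $v\cdot w=\sum_i v_iw_i$ is the standard scalar product over $\mathbb{F}_2$. Property $(P_2)$ with respect to $S$: let $S$ be a subspace of $\mathbb{F}_2^m$ with $1\le\dim(S)\le m-1$ such that $D_aD_b\pi=0_m$ for all $a,b\in S$. Then $\pi$ satisfies $(P_2)$ with respect to $S$ if there does not exist a linear subspace $V$ of $\mathbb{F}_2^m$ with $\dim(V)=m-\dim(S)$ such that $v\cdot D_a\pi(y)=0$ for all $a\in S$, all $y\in\mathbb{F}_2^m$ and all $v\in V$. *)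

(* Defs.v *)
From HB Require Import structures.
From mathcomp Require Import all_boot all_order all_fingroup all_algebra.

Set Implicit Arguments.
Unset Strict Implicit.
Unset Printing Implicit Defensive.

Import GRing.Theory.
Local Open Scope ring_scope.

Definition dotp (m : nat) (v w : 'rV['F_2]_m) : 'F_2 :=
  \sum_(i < m) v 0 i * w 0 i.

Definition deriv1 (m : nat) (a : 'rV['F_2]_m)
    (F : 'rV['F_2]_m -> 'rV['F_2]_m) (y : 'rV['F_2]_m) : 'rV['F_2]_m :=
  F (y + a) + F y.

Definition deriv2 (m : nat) (a b : 'rV['F_2]_m)
    (F : 'rV['F_2]_m -> 'rV['F_2]_m) (y : 'rV['F_2]_m) : 'rV['F_2]_m :=
  F (y + a + b) + F (y + a) + F (y + b) + F y.

(* Property (P2) of F with respect to S.  It is only considered for S with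
   1 <= \dim S <= m - 1 on which all second derivatives of F vanish; users
   assume this separately.  The subtraction is exact, as \dim S <= m. *)
Definition propertyP2 (m : nat) (F : 'rV['F_2]_m -> 'rV['F_2]_m)
    (S : {vspace 'rV['F_2]_m}) : Prop :=
  ~ exists V : {vspace 'rV['F_2]_m},
      \dim V = (m - \dim S)%N /\
      forall a y v : 'rV['F_2]_m, a \in S -> v \in V ->
        dotp v (deriv1 a F y) = 0.

Definition derivSpan (m : nat) (F : 'rV['F_2]_m -> 'rV['F_2]_m)
    (S : {vspace 'rV['F_2]_m}) : {vspace 'rV['F_2]_m} :=
  <<[seq deriv1 a F y | a <- enum S, y <- enum 'rV['F_2]_m]>>%VS.

(* Main.v *)
Require Import Defs.
From mathcomp Require Import all_boot all_order all_fingroup all_algebra.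

(** The annihilation condition in (P2) says that V is contained in the
    orthogonal complement of the span V_S of all derivatives of pi in
    directions from S.  The standard scalar product is nondegenerate, so this
    complement has dimension m - dim V_S ([dim_orthv]), although it may meet
    V_S nontrivially.  A subspace contains subspaces of every smaller dimension
    ([exists_subspace_dim]), hence a V of dimension m - dim S exists exactly when
    m - dim S <= m - dim V_S, that is, when dim V_S <= dim S; (P2) is the
    negation of this. *)

Import GRing.Theory.
Local Open Scope ring_scope.

Lemma dotpC m (v w : 'rV['F_2]_m) : dotp v w = dotp w v.
Proof. by apply: eq_bigr => i _; rewrite mulrC. Qed.

Lemma dotp_sumr m n (v : 'rV['F_2]_m) (c : 'I_n -> 'F_2)
    (w : 'I_n -> 'rV['F_2]_m) :
  dotp v (\sum_i c i *: w i) = \sum_i c i * dotp v (w i).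
Proof.
under [RHS]eq_bigr => i _ do rewrite /dotp mulr_sumr.
rewrite exchange_big; apply: eq_bigr => j _ /=.
rewrite summxE mulr_sumr; apply: eq_bigr => i _.
by rewrite mxE mulrCA.
Qed.

Definition basis_mx {m} (W : {vspace 'rV['F_2]_m}) : 'M['F_2]_(\dim W, m) :=
  \matrix_(i < \dim W) (vbasis W)`_i.

Definition orthv {m} (W : {vspace 'rV['F_2]_m}) : {vspace 'rV['F_2]_m} :=
  lker (linfun (mulmxr (basis_mx W)^T)).

Lemma row_free_basis_mx m (W : {vspace 'rV['F_2]_m}) : row_free (basis_mx W).
Proof.
rewrite -kermx_eq0; apply/rowV0P => u /sub_kermxP uB0.
have /freeP free_W := basis_free (vbasisP W).
apply/rowP => i; rewrite mxE; apply: (free_W (u 0)).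
apply: etrans uB0; rewrite mulmx_sum_row; apply: eq_bigr => j _.
by rewrite rowK.
Qed.

Lemma orthvP m (W : {vspace 'rV['F_2]_m}) (v : 'rV['F_2]_m) :
  reflect (forall w, w \in W -> dotp v w = 0) (v \in orthv W).
Proof.
have entryE j : (v *m (basis_mx W)^T) 0 j = dotp v (vbasis W)`_j.
  by rewrite mxE /dotp; apply: eq_bigr => i _; rewrite !mxE.
rewrite memv_ker lfunE /=; apply: (iffP eqP) => [vB0 w wW | vW0].
  rewrite (coord_vbasis wW) dotp_sumr big1 // => j _.
  by rewrite -entryE vB0 mxE mulr0.
apply/rowP => j; rewrite entryE mxE vW0 //.
by apply/vbasis_mem/mem_nth; rewrite size_tuple.
Qed.

(** Pairing with a basis of W is onto, because the matrix of a basis has full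
    rank; the dimension of its kernel follows by rank-nullity. *)
Lemma dim_orthv m (W : {vspace 'rV['F_2]_m}) :
  \dim (orthv W) = (m - \dim W)%N.
Proof.
pose f := linfun (mulmxr (basis_mx W)^T) : 'Hom('rV['F_2]_m, 'rV['F_2]_(\dim W)).
have f_onto : limg f = fullv.
  apply/eqP; rewrite eqEsubv subvf; apply/subvP => u _.
  have full : row_full (basis_mx W)^T.
    by rewrite /row_full mxrank_tr; apply: row_free_basis_mx.
  have -> : u = f (u *m pinvmx (basis_mx W)^T).
    by rewrite lfunE /= mulmxKpV // submx_full.
  by rewrite memv_img ?memvf.
have := limg_ker_dim f fullv.
rewrite capfv f_onto !dimvf !dim_matrix !mul1r.
exact: (canRL (addnK _)).
Qed.

Lemma exists_subspace_dim (K : fieldType) (vT : vectType K) (W : {vspace vT}) d :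
  (d <= \dim W)%N -> exists2 V : {vspace vT}, (V <= W)%VS & \dim V = d.
Proof.
move=> le_dW; exists <<take d (vbasis W)>>%VS.
  by apply/span_subvP => x /mem_take /vbasis_mem.
have /catl_free/eqP -> : free (take d (vbasis W) ++ drop d (vbasis W)).
  by rewrite cat_take_drop (basis_free (vbasisP W)).
by rewrite size_takel // size_tuple.
Qed.

(** Orthogonality to v is a linear condition, so it passes from the
    derivatives to their span. *)
Lemma orthv_derivSpanP m (F : 'rV['F_2]_m -> 'rV['F_2]_m)
    (S : {vspace 'rV['F_2]_m}) (v : 'rV['F_2]_m) :
  reflect (forall a y, a \in S -> dotp v (deriv1 a F y) = 0)
          (v \in orthv (derivSpan F S)).
Proof.
apply: (iffP (orthvP _ _ _)) => [v0 a y aS | v0 w].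
  apply/v0/memv_span/allpairsP.
  by exists (a, y); rewrite !mem_enum.
have /subvP sub : (derivSpan F S <= orthv <[v]>)%VS.
  apply/span_subvP => _ /allpairsP[[a y] /= [aS _ ->]].
  rewrite mem_enum in aS; apply/orthvP => _ /vlineP[c ->].
  have := dotp_sumr _ 1%N (deriv1 a F y) (fun=> c) (fun=> v).
  by rewrite !big_ord1 => ->; rewrite dotpC v0 // mulr0.
by move=> /sub/orthvP/(_ v (memv_line v)); rewrite dotpC.
Qed.

Theorem proposition3p6 (m k : nat) (pi : {perm 'rV['F_2]_m})
    (S : {vspace 'rV['F_2]_m})
    (hk : (1 <= k <= m - 1)%N) (hS : \dim S = k)
    (hD : forall a b : 'rV['F_2]_m, a \in S -> b \in S ->
      forall y : 'rV['F_2]_m, deriv2 a b pi y = 0) :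
  propertyP2 pi S <-> (\dim (derivSpan pi S) > \dim S)%N.
Proof.
have le_m (U : {vspace 'rV['F_2]_m}) : (\dim U <= m)%N.
  by have := dimvS (subvf U); rewrite dimvf dim_matrix mul1r.
split=> [P2 | lt_dim [V [dimV V0]]].
  rewrite ltnNge; apply/negP => le_dim; apply: P2.
  have [|V /subvP sVW dimV] :=
      @exists_subspace_dim _ _ (orthv (derivSpan pi S)) (m - \dim S).
    by rewrite dim_orthv leq_sub2l.
  by exists V; split=> // a y v aS /sVW/orthv_derivSpanP; apply.
have : (V <= orthv (derivSpan pi S))%VS.
  by apply/subvP => v vV; apply/orthv_derivSpanP => a y aS; apply: V0.
move=> /dimvS; rewrite dimV dim_orthv leqNgt => /negP; apply.
by rewrite ltn_sub2l // (leq_trans lt_dim).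
Qed.
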